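(* Let $m\colon X\times X\to X$ be a relative H*-algebra. Define $\mathbf{G}$ by $G_1=X$, $G_0=\{f\in X\mid ff=f\}$, $$s=\{(f,f^*f)\mid f^*\text{ a pseudoinverse of }f\}\subseteq G_1\times G_0,\qquad t=\{(f,ff^* )\mid f^*\text{ a pseudoinverse of }f\}\subseteq G_1\times G_0,$$ with composition given by $m$ (restricted to pairs $(g,f)$ with $s(g)=t(f)$). Then $\mathbf{G}$ is a locally cancellative regular semigroupoid.
   Context: $\mathbf{Rel}$ is the category of sets and relations, with relational composition, converse $r^\dagger$, monoidal product $\times$ given by Cartesian product of sets, and $1$ denoting identities and the one-point set; coherence isomorphisms are suppressed. A relative H*-algebra is a relation $m\colon X\times X\to X$ in $\mathbf{Rel}$ satisfying (M) $m\circ m^\dagger=1$; (A) $m\circ(1\times m)=m\circ(m\times 1)$; (H) there is an involution $*\colon\mathbf{Rel}(1,X)\to\mathbf{Rel}(1,X)$ such that $m\circ(1\times x^* )=(1\times x^\dagger)\circ m^\dagger$ and $m\circ(x^*\times 1)=(x^\dagger\times 1)\circ m^\dagger$ for all $x\colon 1\to X$. By (M), $m$ is single-valued; write $hg=f$ for $((h,g),f)\in m$. A pseudoinverse of $f\in X$ is $f^*\in X$ with $f=ff^*f$ and $f^*=f^*ff^*$ (all products being defined). A semigroupoid consists of sets $G_0$ (objects), $G_1$ (morphisms), functions $s,t\colon G_1\to G_0$ (source, target) and an associative composition $m\colon G_1\times_{G_0}G_1\to G_1$, $(g,f)\mapsto gf$ for $s(g)=t(f)$ (a category without identities); it is assumed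 that $G_0=s(G_1)\cup t(G_1)$. A pseudoinverse of $f\in G_1$ is $f^*\in G_1$ with $s(f)=t(f^* )$, $t(f)=s(f^* )$, $f=ff^*f$, $f^*=f^*ff^*$. A semigroupoid is regular when every $f\in G_1$ has a pseudoinverse; it is locally cancellative when $fhh^*=gh^*$ implies $fh=g$, and $h^*hf=h^*g$ implies $hf=g$, for any $f,g,h\in G_1$ and any pseudoinverse $h^*$ of $h$. *)

(* Defs.v *)
From mathcomp Require Import all_boot.
From mathcomp Require Import boolp classical_sets.

Set Implicit Arguments.
Unset Strict Implicit.
Unset Printing Implicit Defensive.

Local Open Scope classical_set_scope.

Definition Rel (A B : Type) := set (A * B).

Declare Scope Rel_scope.
Delimit Scope Rel_scope with Rel.
Bind Scope Rel_scope with Rel.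
Local Open Scope Rel_scope.

(* Despite its look, [s \; r] in [relation_scope] is s after r. *)
Definition rcomp (A B C : Type) (s : Rel B C) (r : Rel A B) : Rel A C :=
  (s \; r)%relation.

Definition converse (A B : Type) (r : Rel A B) : Rel B A :=
  (r^-1)%relation.

Notation "s \o r" := (rcomp s r) : Rel_scope.
Notation "r ^-1" := (converse r) : Rel_scope.

Definition rtimes (A B C D : Type) (r : Rel A B) (s : Rel C D) :
  Rel (A * C) (B * D) :=
  [set p | r (p.1.1, p.2.1) /\ s (p.1.2, p.2.2)].

Definition graph (A B : Type) (f : A -> B) : Rel A B :=
  [set p | f p.1 = p.2].

Definition assoc_iso {A B C : Type} : Rel (A * B * C) (A * (B * C)) :=
  graph (fun p => (p.1.1, (p.1.2, p.2))).

Definition lunit_iso {A : Type} : Rel (unit * A) A := graph snd.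

Definition runit_iso {A : Type} : Rel (A * unit) A := graph fst.

(* In [Hstar_H] the unit isomorphisms turn both sides into endorelations of X;
   [star] is only required to be an involutive map on the set Rel(1, X). *)
Record relative_Hstar_algebra (X : Type) (m : Rel (X * X) X) : Prop := {
  Hstar_M : m \o m^-1 = diagonal;
  Hstar_A : m \o rtimes diagonal m \o assoc_iso = m \o rtimes m diagonal;
  Hstar_H : exists star : Rel unit X -> Rel unit X,
    involutive star /\
    forall x : Rel unit X,
      m \o rtimes diagonal (star x) \o runit_iso^-1
        = runit_iso \o rtimes diagonal (x^-1) \o m^-1
      /\
      m \o rtimes (star x) diagonal \o lunit_iso^-1
        = lunit_iso \o rtimes (x^-1) diagonal \o m^-1
}.

(* [prod3 m a b c d]: the product (ab)c is defined and equal to d. *)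
Definition prod3 (X : Type) (m : Rel (X * X) X) (a b c d : X) : Prop :=
  exists2 k, m ((a, b), k) & m ((k, c), d).

Definition Hstar_pseudoinverse (X : Type) (m : Rel (X * X) X) (f f' : X) :
  Prop :=
  prod3 m f f' f f /\ prod3 m f' f f' f'.

Definition idempotents (X : Type) (m : Rel (X * X) X) : Type :=
  {f : X | m ((f, f), f)}.

Definition Hstar_source (X : Type) (m : Rel (X * X) X) :
  Rel X (idempotents m) :=
  [set p | exists2 f', Hstar_pseudoinverse m p.1 f'
                     & m ((f', p.1), proj1_sig p.2)].

Definition Hstar_target (X : Type) (m : Rel (X * X) X) :
  Rel X (idempotents m) :=
  [set p | exists2 f', Hstar_pseudoinverse m p.1 f'
                     & m ((p.1, f'), proj1_sig p.2)].

Arguments Hstar_source {X} m.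
Arguments Hstar_target {X} m.

(* The laws [src_gcomp] and [tgt_gcomp] are what makes both bracketings in
   [gcompA] meaningful. *)
Record semigroupoid (G0 G1 : Type) := Semigroupoid {
  src : G1 -> G0;
  tgt : G1 -> G0;
  gcomp : forall g f : G1, src g = tgt f -> G1;
  src_gcomp : forall g f (gf : src g = tgt f), src (gcomp gf) = src f;
  tgt_gcomp : forall g f (gf : src g = tgt f), tgt (gcomp gf) = tgt g;
  gcompA : forall h g f (hg : src h = tgt g) (gf : src g = tgt f)
             (h_gf : src h = tgt (gcomp gf)) (hg_f : src (gcomp hg) = tgt f),
    gcomp h_gf = gcomp hg_f;
  objects_covered : range src `|` range tgt = setT
}.

Section SemigroupoidNotions.
Variables (G0 G1 : Type) (G : semigroupoid G0 G1).

(* Composition as a relation: the pair (g, f) is related to h when g and f are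
   composable and gf = h. *)
Definition comp_rel : Rel (G1 * G1) G1 :=
  [set p | exists gf : src G p.1.1 = tgt G p.1.2, gcomp gf = p.2].

Definition pseudoinverse (f f' : G1) : Prop :=
  [/\ src G f = tgt G f', tgt G f = src G f',
      prod3 comp_rel f f' f f & prod3 comp_rel f' f f' f'].

Definition regular : Prop := forall f, exists f', pseudoinverse f f'.

Definition locally_cancellative : Prop :=
  forall f g h h' : G1, pseudoinverse h h' ->
    (forall k, prod3 comp_rel f h h' k -> comp_rel ((g, h'), k) ->
       comp_rel ((f, h), g))
    /\
    (forall k, prod3 comp_rel h' h f k -> comp_rel ((h', g), k) ->
       comp_rel ((h, f), g)).

End SemigroupoidNotions.

(* Main.v *)
Require Import Defs.
From mathcomp Require Import all_boot.
From mathcomp Require Import boolp classical_sets.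

(** The heart of the matter is that the involution [star], which a priori only
    acts on subsets of [X], restricts to an involution [inv] of [X] itself
    (lemma [star_singleton]).  For a singleton [{q}], axiom (H) says that
    [p q = r] holds iff [r a = p] for some [a] in [{q}*], and dually on the
    left.  If [a] is in [{q}*] and [z] is in [{a}*], evaluating [q a z] in both
    ways forces [z = q].  So [{a}* = {q}], and since [star] is an involution,
    [{q}* = {a}].

    After that, (H) is a pair of division rules: [f q = g] implies
    [g (inv q) = f], and [q f = g] implies [(inv q) g = f].  Together with
    associativity of the partial product they say that [X] is the set of
    morphisms of a groupoid.  Indeed [q (inv q)] is always defined, it is an
    idempotent that is a left unit of [q], and [inv q] is the only
    pseudoinverse of [q]; hence source and target are functions.  A product
    [g f] is defined iff [(inv g) g = f (inv f)], so the composition of the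
    semigroupoid is [m] itself, and local cancellation follows at once from the
    division rules. *)

Set Implicit Arguments.
Unset Strict Implicit.
Unset Printing Implicit Defensive.

Local Open Scope classical_set_scope.

(** * The axioms of a relative H*-algebra in terms of elements *)

Section Elementwise.
Variables (X : Type) (m : Rel (X * X) X).
Hypothesis Hm : relative_Hstar_algebra m.

Lemma product_functional p k k' : m (p, k) -> m (p, k') -> k = k'.
Proof.
move=> mk mk'; have /seteqP[sub _] := Hstar_M Hm.
by apply: (sub (k, k')); exists p.
Qed.

Lemma product_surjective q : exists p, m (p, q).
Proof.
have /seteqP[_ sub] := Hstar_M Hm.
by have [|p _ mp] := sub (q, q); [|exists p].
Qed.

Lemma product_assocl h g f j k :
  m ((g, f), j) -> m ((h, j), k) -> exists2 l, m ((h, g), l) & m ((l, f), k).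
Proof.
move=> mj mk; have /seteqP[sub _] := Hstar_A Hm.
have [|[l f'] [/= ml ff'] mlf] := sub ((h, g, f), k).
  by exists (h, (g, f)) => //; exists (h, j).
by exists l => //; rewrite [f]ff'.
Qed.

Lemma product_assocr h g f l k :
  m ((h, g), l) -> m ((l, f), k) -> exists2 j, m ((g, f), j) & m ((h, j), k).
Proof.
move=> ml mk; have /seteqP[_ sub] := Hstar_A Hm.
have [|[h' [g' f']] e [[h'' j] [/= hh' mj] mjk]] := sub ((h, g, f), k).
  by exists (l, f).
case: e mj hh' mjk => /= <- <- <- mj hh' mjk; exists j => //.
by rewrite [h]hh'.
Qed.

Variable star : Rel unit X -> Rel unit X.
Hypothesis starK : involutive star.
Hypothesis starH : forall x : Rel unit X,
  (rcomp (rcomp m (rtimes diagonal (star x))) (converse runit_iso)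
    = rcomp (rcomp runit_iso (rtimes diagonal (converse x))) (converse m)) /\
  (rcomp (rcomp m (rtimes (star x) diagonal)) (converse lunit_iso)
    = rcomp (rcomp lunit_iso (rtimes (converse x) diagonal)) (converse m)).

(** These two lemmas are axiom (H): the unit isomorphisms only carry the
    one-point coordinates around.  A point of [x] or of its star is existentially
    quantified on both sides, so from a given product one only learns that some
    element of [star x] divides it back. *)
Lemma star_divr x g f :
  (exists2 a, star x (tt, a) & m ((g, a), f)) <->
  (exists2 a, x (tt, a) & m ((f, a), g)).
Proof.
have [/seteqP[sub sub'] _] := starH x; split=> -[a xa ma].
  have [|[p q] mpq [[p' []] [/= pp' xq] p'f]] := sub (g, f).
    by exists (g, tt) => //; exists (g, a).
  by exists q => //; rewrite -[f]p'f -[p']pp'.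
have [|[p []] pg [[p' q] [/= pp' xq] mf]] := sub' (g, f).
  by exists (f, a) => //; exists (f, tt).
by exists q => //; move: mf; rewrite -[p']pp' [p]pg.
Qed.

Lemma star_divl x g f :
  (exists2 a, star x (tt, a) & m ((a, g), f)) <->
  (exists2 a, x (tt, a) & m ((a, f), g)).
Proof.
have [_ /seteqP[sub sub']] := starH x; split=> -[a xa ma].
  have [|[q p] mqp [[[] p'] [/= xq pp'] p'f]] := sub (g, f).
    by exists (tt, g) => //; exists (a, g).
  by exists q => //; rewrite -[f]p'f -[p']pp'.
have [|[[] p] pg [[q p'] [/= xq pp'] mf]] := sub' (g, f).
  by exists (a, f) => //; exists (tt, f).
by exists q => //; move: mf; rewrite -[p']pp' [p]pg.
Qed.

Local Notation pt q := ([set (tt, q)] : Rel unit X).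

(** A member of [{q}*] comes from a product with [q] as right factor; dividing
    a factorisation [q = u v] by [u] produces one. *)
Lemma star_pt_nonempty q : exists a, star (pt q) (tt, a).
Proof.
have [[u v] muv] := product_surjective q.
have [_ [|b _ mb]] := star_divl (pt u) q v; first by exists u.
have [_ [|a sa _]] := star_divr (pt q) v b; first by exists q.
by exists a.
Qed.

Lemma star_pt_divr q a u v :
  star (pt q) (tt, a) -> m ((u, a), v) -> m ((v, q), u).
Proof.
move=> sa ma; have [[|b [->]]//] := star_divr (pt q) u v.
by exists a.
Qed.

Lemma star_pt_divl q a u v :
  star (pt q) (tt, a) -> m ((a, u), v) -> m ((q, v), u).
Proof.
move=> sa ma; have [[|b [->]]//] := star_divl (pt q) u v.
by exists a.
Qed.

(** Every element is a left factor of some product, and [z u = v] with [z] in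
    [{a}*] gives [a v = u], hence [z (a v) = v]. *)
Lemma star_pt_composable a z :
  star (pt a) (tt, z) -> exists w, m ((z, a), w).
Proof.
move=> sz; have [[v b] mvb] := product_surjective z.
have [_ [|u _ mzu]] := star_divr (pt b) z v; first by exists b.
by have [w] := product_assocl (star_pt_divl sz mzu) mzu; exists w.
Qed.

(** Once [z a] is known to be defined, both [q (a z) = z] and [q (a q) = q],
    while [a z = a q]; so [z] and [q] are the same product. *)
Lemma star_pt_twice q a z :
  star (pt q) (tt, a) -> star (pt a) (tt, z) -> z = q.
Proof.
move=> sa sz; have [w mza] := star_pt_composable sz.
have [aq maq mzaq] := product_assocr mza (star_pt_divr sa mza).
apply: (product_functional _ (star_pt_divl sa maq)).
exact: (star_pt_divl sa (star_pt_divl sz mzaq)).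
Qed.

(** For [a] in [{q}*], the previous lemma says that [{a}*] has no member but [q];
    as it is not empty, applying [star] to [{a}* = {q}] gives [{q}* = {a}]. *)
Lemma star_singleton q : exists a, star (pt q) = pt a.
Proof.
have [a sa] := star_pt_nonempty q; exists a.
suff <- : star (pt a) = pt q by rewrite starK.
have [z sz] := star_pt_nonempty a.
apply/seteqP; split=> [[[] z'] /= sz' | [[] _] [->]].
  by rewrite (star_pt_twice sa sz').
by rewrite -(star_pt_twice sa sz).
Qed.

(** Reading (H) at [{inv q}], whose star is [{q}], removes the existential
    quantifiers and leaves plain division by [q]. *)
Lemma star_inverse :
  exists inv : X -> X,
    [/\ involutive inv,
        forall q f g, m ((f, q), g) -> m ((g, inv q), f)
      & forall q f g, m ((q, f), g) -> m ((inv q, g), f)].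
Proof.
have [inv invP] := choice star_singleton.
have inv_star q : star (pt q) (tt, inv q) by rewrite invP.
have invK : involutive inv.
  by move=> q; exact: (star_pt_twice (inv_star q) (inv_star _)).
have inv_star_sym q : star (pt (inv q)) (tt, q) by rewrite invP invK.
exists inv; split=> // q f g mg.
  exact: (star_pt_divr (inv_star_sym q) mg).
exact: (star_pt_divl (inv_star_sym q) mg).
Qed.

End Elementwise.

(** * The groupoid of a partial associative product with division *)

Section Division.
Variables (X : Type) (m : Rel (X * X) X) (inv : X -> X).
Hypothesis Hm : relative_Hstar_algebra m.
Hypothesis invK : involutive inv.
Hypothesis divr : forall [q f g], m ((f, q), g) -> m ((g, inv q), f).
Hypothesis divl : forall [q f g], m ((q, f), g) -> m ((inv q, g), f).

Lemma divrV q f g : m ((f, inv q), g) -> m ((g, q), f).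
Proof. by move/divr; rewrite invK. Qed.

Lemma divlV q f g : m ((inv q, f), g) -> m ((q, g), f).
Proof. by move/divl; rewrite invK. Qed.

(** For [q = u v], division gives [(inv u) q = v] and [v (inv q) = inv u], that
    is, [((inv u) q) (inv q)] is defined; associativity then makes [q (inv q)]
    defined.  It is idempotent because it is a left unit of [q]. *)
Lemma mul_inv_idempotent q :
  exists e : idempotents m, m ((q, inv q), proj1_sig e).
Proof.
have [[u v] /divl muq] := product_surjective Hm q.
have [e me _] := product_assocr Hm muq (divr muq).
have [e' me' mee] := product_assocr Hm (divrV me) me.
rewrite (product_functional Hm me' me) in mee.
by exists (exist _ e mee).
Qed.

Lemma inv_mul_idempotent q :
  exists e : idempotents m, m ((inv q, q), proj1_sig e).
Proof. by have := mul_inv_idempotent (inv q); rewrite invK. Qed.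

Lemma inv_pseudoinverse q : Hstar_pseudoinverse m q (inv q).
Proof.
split; have [[e /= _] me] := mul_inv_idempotent q.
  by exists e => //; apply: divrV.
have [[e' /= _] me'] := inv_mul_idempotent q.
by exists e' => //; apply: (divr me').
Qed.

(** Dividing [(q q') q = q] by [q] on the right gives [q q' = q (inv q)], and [q]
    can then be divided out on the left.  This uniqueness makes the source and
    target relations single-valued. *)
Lemma pseudoinverse_inv q q' : Hstar_pseudoinverse m q q' -> q' = inv q.
Proof.
move=> [[k mk /divr mk'] [j _ _]].
exact: (product_functional Hm (divl mk) (divl mk')).
Qed.

(** From [g f = k] follows [(inv k) g = inv f], so [(inv f) f = (inv k) (g f)]:
    the source of a composite is that of its first factor. *)
Lemma inv_mul_composite g f k e :
  m ((g, f), k) -> m ((inv f, f), e) -> m ((inv k, k), e).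
Proof.
move=> mk me; have [j mj] := product_assocr Hm (divl (divr mk)) me.
by rewrite (product_functional Hm mj mk).
Qed.

Lemma mul_inv_composite g f k e :
  m ((g, f), k) -> m ((g, inv g), e) -> m ((k, inv k), e).
Proof.
move=> mk me; have [j mj] := product_assocl Hm (divr (divl mk)) me.
by rewrite (product_functional Hm mj mk).
Qed.

(** If [g f] is defined then [g (f (inv f)) = g], and dividing by [g] identifies
    [f (inv f)] with [(inv g) g].  Conversely, if these idempotents agree then
    [g (f (inv f))] is defined, and so is [g f] by associativity. *)
Lemma composableP g f e e' :
  m ((inv g, g), e) -> m ((f, inv f), e') ->
  (exists k, m ((g, f), k)) <-> e = e'.
Proof.
move=> me me'; split=> [[k mk]|ee'].
  have [j mj mgj] := product_assocr Hm mk (divr mk).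
  rewrite (product_functional Hm me' mj).
  exact: (product_functional Hm me (divl mgj)).
have mge := divlV me; rewrite ee' in mge.
by have [k] := product_assocl Hm me' mge; exists k.
Qed.

Lemma division_semigroupoid :
  exists G : semigroupoid (idempotents m) X,
    [/\ graph (src G) = Hstar_source m,
        graph (tgt G) = Hstar_target m,
        comp_rel G = m `&` [set p | src G p.1.1 = tgt G p.1.2],
        regular G
      & locally_cancellative G].
Proof.
have [s sP] := choice inv_mul_idempotent.
have [t tP] := choice mul_inv_idempotent.
have val_inj (e e' : idempotents m) : proj1_sig e = proj1_sig e' -> e = e'.
  by move: e e' => [e me] [e' me'] /= ee'; apply: eq_exist.
have st g f : (exists k, m ((g, f), k)) <-> s g = t f.
  rewrite (composableP (sP g) (tP f)); split=> [|->] //; exact: val_inj.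
pose mul g f (gf : s g = t f) := proj1_sig (cid ((st g f).2 gf)).
have mulP g f (gf : s g = t f) : m ((g, f), mul g f gf).
  by rewrite /mul; case: cid.
have s_mul g f (gf : s g = t f) : s (mul g f gf) = s f.
  apply: val_inj; apply: (product_functional Hm (sP _) _).
  exact: (inv_mul_composite (mulP _ _ gf) (sP f)).
have t_mul g f (gf : s g = t f) : t (mul g f gf) = t g.
  apply: val_inj; apply: (product_functional Hm (tP _) _).
  exact: (mul_inv_composite (mulP _ _ gf) (tP g)).
have mulA h g f (hg : s h = t g) (gf : s g = t f)
    (h_gf : s h = t (mul g f gf)) (hg_f : s (mul h g hg) = t f) :
    mul h _ h_gf = mul _ f hg_f.
  have [l ml mlf] := product_assocl Hm (mulP _ _ gf) (mulP _ _ h_gf).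
  rewrite (product_functional Hm ml (mulP _ _ hg)) in mlf.
  exact: (product_functional Hm mlf (mulP _ _ hg_f)).
have cover : range s `|` range t = setT.
  apply/seteqP; split=> // e _; left; exists (proj1_sig e) => //.
  apply: val_inj; apply: (product_functional Hm (sP _) _).
  exact: (divl (proj2_sig e)).
pose G := Semigroupoid s_mul t_mul mulA cover.
have compE g f k : comp_rel G ((g, f), k) <-> m ((g, f), k).
  split=> [[/= gf <-]|mk]; first exact: (mulP g f gf).
  have gf : s g = t f by apply/st; exists k.
  by exists gf; apply: (product_functional Hm (mulP _ _ gf) mk).
have prod3E a b c d : prod3 (comp_rel G) a b c d <-> prod3 m a b c d.
  by split=> -[k mk mk']; exists k; apply/compE.
exists G; split.
- rewrite /graph.
  apply/seteqP; split=> [[f e] /= <-|[f e] [f' /pseudoinverse_inv -> me]] /=.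
    by exists (inv f); [apply: inv_pseudoinverse | apply: sP].
  exact/val_inj/(product_functional Hm (sP f) me).
- rewrite /graph.
  apply/seteqP; split=> [[f e] /= <-|[f e] [f' /pseudoinverse_inv -> me]] /=.
    by exists (inv f); [apply: inv_pseudoinverse | apply: tP].
  exact/val_inj/(product_functional Hm (tP f) me).
- apply/seteqP; split=> [[[g f] k] c|[[g f] k] [mk _]]; last exact/compE.
  by split; [apply/compE | have [] := c].
- move=> f; exists (inv f).
  have [[k mk mk'] [j mj mj']] := inv_pseudoinverse f.
  split; [apply/st; by exists k | apply/esym/st; by exists j
         | apply/prod3E; by exists k | apply/prod3E; by exists j].
- move=> f g h h' _; split=> k /prod3E [l ml mlk] /compE mk; apply/compE.
    by rewrite -(product_functional Hm (divr mlk) (divr mk)).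
  (* [prod3] brackets the product as [(h' h) f], whereas [h'] is to be divided
     out of [h' (h f)]. *)
  have [j mj mh'j] := product_assocr Hm ml mlk.
  by rewrite -(product_functional Hm (divl mh'j) (divl mk)).
Qed.

End Division.

Theorem theorem29 (X : Type) (m : Rel (X * X) X)
    (Hm : relative_Hstar_algebra m) :
  exists G : semigroupoid (idempotents m) X,
    [/\ graph (src G) = Hstar_source m,
        graph (tgt G) = Hstar_target m,
        comp_rel G = m `&` [set p | src G p.1.1 = tgt G p.1.2],
        regular G
      & locally_cancellative G].
Proof.
have [star [starK starH]] := Hstar_H Hm.
have [inv [invK divr divl]] := star_inverse Hm starK starH.
exact: (division_semigroupoid Hm invK divr divl).
Qed.
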